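(* For every $n\ge3$, the involution $\Delta_n:\mathcal{E}_n\to\mathcal{E}_n$ is the unique bijection of the set $\mathcal{E}_n$ onto itself which reverses the staircase partial order $\preceq$.
   Context: A plane branch is a reduced irreducible germ $(C,O)$ of complex analytic curve on a germ $(\mathcal{S},O)$ of smooth complex analytic surface. A model over $(\mathcal{S},O)$ is a composition of finitely many blow-ups of points above $O$. An infinitely near point of $O$ is a point lying over $O$ on some model, two such points being identified when the bimeromorphic map between the models is an isomorphism near them. $E(P)$ denotes the exceptional curve created by blowing up $P$, and also its strict transforms. $Q$ is proximate to $P$ if $Q\in E(P)$. A point $\neq O$ is free if it is proximate to exactly one point, and satellite if it is proximate to two. The minimal embedded resolution of $(C,O)$ is obtained by repeatedly blowing up the unique point where the total transform of $C$ is not a normal crossing. Let $P_0=O,P_1,\dots,P_{n-1}$ be the points blown up, in order; $n$ is the blow-up complexity of $C$ ($n=0$ if $C$ is smooth, $n\ge3$ otherwise). Enriques diagram of $C$ (for $n\ge3$): the path graph with vertices $v_0,\dots,v_{n-1}$ (with $v_i$ corresponding to $P_i$) and edges $e_i=[v_{i-1}v_i]$, $1\le i\le n-1$, where each edge is decorated as curved or straight and each vertex as breaking or neutral, as follows. A straight path is a path of straight edges all of whose interior vertices are neutral; it is maximal if adding an adjacent edge never gives a straight path. (1) $e_i$ is curved iff $P_i$ is free. (2) If $P_{i+1},\dots,P_k$ are all the points of the sequence proximate to $P_i$ and $k\ge i+2$, then $[v_{i+1}v_k]$ is a maximal straight path, and if moreover $e_{i+1}$ is straight then $v_{i+1}$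 is a breaking vertex. All other vertices are neutral. $\mathcal{E}_n$ is the set of isomorphism classes of Enriques diagrams of plane branches of blow-up complexity $n$. Always $e_1$ is curved, $e_{n-1}$ is straight and $v_0,v_1,v_{n-1}$ are neutral; a decoration with these properties is an Enriques diagram of complexity $n$ iff both edges adjacent to every breaking vertex are straight. Let $S_n=\{v_2,\dots,v_{n-2},e_2,\dots,e_{n-2}\}$ (a set of symbols). The code $\chi(\epsilon)\subseteq S_n$ of $\epsilon\in\mathcal{E}_n$ is the set of symbols in $S_n$ of the straight edges and of the breaking vertices of $\epsilon$. The staircase partial order on $\mathcal{E}_n$ is: $\epsilon\preceq\epsilon'$ iff $\chi(\epsilon)\subseteq\chi(\epsilon')$. The dual Enriques diagram $\Delta_n(\epsilon)\in\mathcal{E}_n$ of $\epsilon\in\mathcal{E}_n$ is defined by the following rules, for $2\le k\le n-2$: $v_k$ is a breaking vertex in $\Delta_n(\epsilon)$ iff $e_{n-k}$ is a curved edge in $\epsilon$; $e_k$ is a straight edge in $\Delta_n(\epsilon)$ iff $v_{n-k}$ is a neutral vertex in $\epsilon$. A bijection $f$ reverses $\preceq$ if $\epsilon\preceq\epsilon'$ implies $f(\epsilon')\preceq f(\epsilon)$. *)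

(* Defs.v *)
From HB Require Import structures.
From mathcomp Require Import all_boot all_order all_algebra.
From mathcomp Require Import boolp classical_sets reals complex.

Set Implicit Arguments.
Unset Strict Implicit.
Unset Printing Implicit Defensive.

Import Order.TTheory GRing.Theory Num.Theory.
Local Open Scope ring_scope.

(** * Convergent power series in one and two variables over C = R[i] *)

(** [a k] is the coefficient of t^k, and [f i j] that of x^i y^j. *)
Definition series1 (R : realType) : Type := nat -> R[i].
Definition series2 (R : realType) : Type := nat -> nat -> R[i].

Section Series.
Variable R : realType.
Implicit Types (a b : series1 R) (f g : series2 R).

Definition mul1 a b : series1 R :=
  fun k => \sum_(i < k.+1) a i * b (k - i)%N.

Definition exp1 a n : series1 R :=
  iter n (mul1 a) (fun k => (k == 0%N)%:R).

(** [add_const c a] is a + c. *)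
Definition add_const (c : R[i]) a : series1 R :=
  fun k => if k is 0 then a 0%N + c else a k.

(** [shift1 a] is t a(t). *)
Definition shift1 a : series1 R :=
  fun k => if k is k'.+1 then a k' else 0.

Definition mul2 f g : series2 R := fun i j =>
  \sum_(k < i.+1) \sum_(l < j.+1) f k l * g (i - k)%N (j - l)%N.

(** f(x(t), y(t)) when x and y have no constant term: x^i y^j then has order at
    least i + j, so only the indices i, j <= k contribute to t^k. *)
Definition pullback (x y : series1 R) f : series1 R := fun k =>
  \sum_(i < k.+1) \sum_(j < k.+1) f i j * mul1 (exp1 x i) (exp1 y j) k.

(** Absolute convergence at t = rho, resp. at (x, y) = (rho, rho), for some
    rho > 0; the modulus of a complex number is an element of R[i]. *)
Definition convergent1 a : Prop :=
  exists rho M : R, 0 < rho /\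
    forall N, \sum_(i < N) `|a i| * (rho%:C)%C ^+ i <= (M%:C)%C.

Definition convergent2 f : Prop :=
  exists rho M : R, 0 < rho /\
    forall N, \sum_(i < N) \sum_(j < N)
      `|f i j| * (rho%:C)%C ^+ (i + j) <= (M%:C)%C.

(** * Plane branches *)

(** A germ of smooth surface is (C^2, 0) in local coordinates, and a reduced
    irreducible curve germ on it is f = 0 with f irreducible in C{x,y}. The
    units of C{x,y} are the series with nonzero constant term. *)
Definition plane_branch f : Prop :=
  [/\ convergent2 f,
      f 0%N 0%N = 0,
      exists i j, f i j != 0
    & forall g h, convergent2 g -> convergent2 h ->
        (forall i j, f i j = mul2 g h i j) ->
        g 0%N 0%N != 0 \/ h 0%N 0%N != 0].

(** t |-> (x(t), y(t)) is the normalization of the branch f = 0: pullback sends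
    C{x,y}/(f) into C{t}, and this is birational, i.e. t is a quotient of two
    elements of the image. *)
Definition normalization f (x y : series1 R) : Prop :=
  [/\ convergent1 x /\ convergent1 y,
      x 0%N = 0 /\ y 0%N = 0,
      forall k, pullback x y f k = 0
    & exists g h, [/\ convergent2 g, convergent2 h,
        exists k, pullback x y h k != 0
      & forall k, pullback x y g k = shift1 (pullback x y h) k]].

(** * Infinitely near points of a branch *)

(** Local data at the point P_k of the strict transform C_k of the branch, in
    coordinates (x, y) centred at P_k: the lift (px, py) to the k-th model of
    the normalization of C, which parametrizes C_k, and the exceptional curves
    through P_k. These are always coordinate axes: [axis_x = Some i] when E(P_i)
    is {x = 0} near P_k, [axis_x = None] when {x = 0} is not exceptional;
    likewise [axis_y] for {y = 0}. *)
Record near_point := NearPoint {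
  px : series1 R;
  py : series1 R;
  axis_x : option nat;
  axis_y : option nat
}.

(** [blow_up k q P Q]: Q describes the point P_(k+1) where C_(k+1) meets E(P_k),
    when P describes P_k. E(P_k) is a projective line, with points
    - [Some c]: the direction y = c x, in the chart (x, y) = (x', x' (y' + c)),
      where E(P_k) is {x' = 0}; the strict transform of {x = 0} avoids this
      point, that of {y = 0} contains it iff c = 0, and it is then {y' = 0};
    - [None]: the direction x = 0, in the chart (x, y) = (x' y', y'), where
      E(P_k) is {y' = 0} and the strict transform of {x = 0} is {x' = 0}. *)
Definition blow_up (k : nat) (q : option R[i]) (P Q : near_point) : Prop :=
  px Q 0%N = 0 /\ py Q 0%N = 0 /\
  match q with
  | Some c => [/\ px Q =1 px P,
                  mul1 (px P) (add_const c (py Q)) =1 py P,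
                  axis_x Q = Some k
                & axis_y Q = if c == 0 then axis_y P else None]
  | None => [/\ py Q =1 py P,
                mul1 (px Q) (py P) =1 px P,
                axis_x Q = axis_x P
              & axis_y Q = Some k]
  end.

(** The total transform of C has normal crossings at the point: C_k is smooth
    there, and meets at most one exceptional curve, transversally. Elsewhere
    the total transform consists of exceptional curves only, which always cross
    normally, so that P_k is the only point to be tested on the k-th model. *)
Definition normal_crossing (P : near_point) : Prop :=
  [/\ px P 1%N != 0 \/ py P 1%N != 0,
      axis_x P = None \/ axis_y P = None,
      axis_x P <> None -> px P 1%N != 0
    & axis_y P <> None -> py P 1%N != 0].

(** P_0, ..., P_(n-1) are the points blown up in the minimal embedded resolution
    of the branch f = 0; so n is its blow-up complexity. The point [P n] is the
    one where the strict transform on the last model meets E(P_(n-1)). *)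
Definition minimal_resolution f (n : nat) (P : nat -> near_point) : Prop :=
  [/\ exists x y, normalization f x y /\ P 0%N = NearPoint x y None None,
      forall k, (k < n)%N -> exists q, blow_up k q (P k) (P k.+1),
      forall k, (k < n)%N -> ~ normal_crossing (P k)
    & normal_crossing (P n)].

(** P_k lies on E(P_i). *)
Definition proximate (P : nat -> near_point) (k i : nat) : Prop :=
  axis_x (P k) = Some i \/ axis_y (P k) = Some i.

Definition free (P : nat -> near_point) (k : nat) : Prop :=
  exists! i, proximate P k i.

(** The points proximate to P_i among P_0, ..., P_(n-1) are P_(i+1), ..., P_k. *)
Definition proximate_run n (P : nat -> near_point) (i k : nat) : Prop :=
  (k < n)%N /\ forall j, (j < n)%N -> (proximate P j i <-> (i < j <= k)%N).

End Series.

(** * Enriques diagrams *)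

(** Decorations of the path graph v_0, ..., v_(n-1). The index i stands for the
    vertex v_i in [breaking], and for the edge e_i = [v_(i-1) v_i] in
    [straight]; as there is no edge e_0, 0 is never in [straight d] for an
    Enriques diagram d. No quotient by isomorphism is needed: reversing the path
    would exchange e_1, which is curved, with e_(n-1), which is straight, so the
    identity is the only possible isomorphism between two Enriques diagrams. *)
Record decoration (n : nat) := Decoration {
  straight : {set 'I_n};
  breaking : {set 'I_n}
}.

Definition decoration_pair n (d : decoration n) := (straight d, breaking d).
Definition pair_decoration n (p : {set 'I_n} * {set 'I_n}) :=
  Decoration p.1 p.2.
Lemma decoration_pairK n : cancel (@decoration_pair n) (@pair_decoration n).
Proof. by case. Qed.

HB.instance Definition _ n :=
  Finite.copy (decoration n) (can_type (@decoration_pairK n)).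

(** The path from v_a to v_b, for a < b. *)
Definition straight_path n (d : decoration n) (a b : nat) : Prop :=
  (forall j : 'I_n, (a < j <= b)%N -> j \in straight d) /\
  (forall j : 'I_n, (a < j < b)%N -> j \notin breaking d).

Definition maximal_straight_path n (d : decoration n) (a b : nat) : Prop :=
  [/\ straight_path d a b,
      (0 < a)%N -> ~ straight_path d a.-1 b
    & (b.+1 < n)%N -> ~ straight_path d a b.+1].

Definition enriques_diagram_of (R : realType) n (P : nat -> near_point R)
    (d : decoration n) : Prop :=
  [/\ forall j : 'I_n, j \in straight d <-> (0 < j)%N /\ ~ free P j,
      forall i k, proximate_run n P i k -> (i.+2 <= k)%N ->
        maximal_straight_path d i.+1 k
    & forall j : 'I_n, j \in breaking d <->
        exists i k, [/\ proximate_run n P i k, (i.+2 <= k)%N,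
                        j = i.+1 :> nat & j \in straight d]].

(** The set E_n. *)
Definition enriques (R : realType) (n : nat) : set (decoration n) :=
  fun d => exists (f : series2 R) (P : nat -> near_point R),
    [/\ plane_branch f, minimal_resolution f n P & enriques_diagram_of P d].
Arguments enriques R n : clear implicits.

(** * The staircase order and the dual diagram *)

(** [inl k] is the symbol v_k and [inr k] the symbol e_k. *)
Definition symbol (n : nat) : finType := ('I_n + 'I_n)%type.

Definition symbols n : {set symbol n} :=
  [set s : 'I_n + 'I_n | match s with
                         | inl k => (2 <= k <= n - 2)%N
                         | inr k => (2 <= k <= n - 2)%N
                         end].

Definition code n (d : decoration n) : {set symbol n} :=
  [set s : 'I_n + 'I_n in symbols n | match s with
                                      | inl k => k \in breaking d
                                      | inr k => k \in straight d
                                      end].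

Definition staircase_le (R : realType) n (e e' : enriques R n) : bool :=
  code (val e) \subset code (val e').

(** The rules by which [e'] is the dual diagram of [e]. *)
Definition dual_of (R : realType) n (e e' : enriques R n) : Prop :=
  forall k l : 'I_n, (2 <= k <= n - 2)%N -> l = (n - k)%N :> nat ->
    (k \in breaking (val e')) = (l \notin straight (val e)) /\
    (k \in straight (val e')) = (l \notin breaking (val e)).

Definition reverses_staircase (R : realType) n
    (f : enriques R n -> enriques R n) : Prop :=
  forall e e', staircase_le e e' -> staircase_le (f e') (f e).

(* Main.v *)
Require Import Defs.
From mathcomp Require Import all_boot all_order all_algebra.
From mathcomp Require Import zify ring.
From mathcomp Require Import boolp classical_sets reals complex.

(** An Enriques diagram of complexity n is encoded by the set of its breaking
    vertices and straight edges among v_(n-2), e_(n-2), ..., v_2, e_2. That a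
    breaking vertex has two straight adjacent edges means that this set is a
    downset of a fence with an even number of elements; the duality is the
    complement followed by the reversal of the fence. An automorphism of the
    lattice of downsets permutes the join-irreducible elements, hence comes from
    an automorphism of the fence, and an even fence has only the identity: its
    only maximal end is fixed, and then its elements one after the other.

    That every such set is realized by a branch: choose the directions of the
    points blown up from the diagram, and blow down t |-> (t, t) along them to
    get polynomials x(t), y(t), of which t is a rational function. They are
    algebraically dependent, and a nonzero series of least order vanishing on
    (x(t), y(t)) is an irreducible equation of the branch. *)

Set Implicit Arguments.
Unset Strict Implicit.
Unset Printing Implicit Defensive.

Import Order.TTheory GRing.Theory Num.Theory.

(** * Automorphisms of the lattice of downsets of a fence *)

(** The map induced on pairs sends the finite set of related pairs injectively into itself, hence
    onto itself. *)
Lemma homo_inj_reflect (T : finType) (r : rel T) (g : T -> T) :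
  injective g -> (forall x y, r x y -> r (g x) (g y)) ->
  forall x y, r (g x) (g y) -> r x y.
Proof.
move=> inj_g homo_g x y rgxy; pose h p := (g p.1, g p.2).
pose A := [set p | r p.1 p.2].
have inj_h : injective h by move=> [a b] [c d] [/inj_g-> /inj_g->].
have hA : h @: A = A.
  apply/eqP; rewrite eqEcard card_imset // leqnn andbT.
  by apply/fintype.subsetP => _ /imsetP[p Ap ->]; move: Ap; rewrite !inE; apply: homo_g.
have : (g x, g y) \in h @: A by rewrite hA inE.
by case/imsetP => -[a b]; rewrite inE /= => rab [/inj_g-> /inj_g->].
Qed.

Definition downset (S : finType) (r : rel S) (D : {set S}) : bool :=
  [forall i in D, forall j, r j i ==> (j \in D)].

Lemma downsetP (S : finType) (r : rel S) (D : {set S}) :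
  reflect (forall i j, i \in D -> r j i -> j \in D) (downset r D).
Proof.
apply: (iffP forall_inP) => [dD i j Di rji|dD i Di].
  by have /forallP/(_ j)/implyP := dD i Di; apply.
by apply/forallP => j; apply/implyP; apply: dD.
Qed.

Section DownsetAutomorphism.
Variables (S : finType) (r : rel S).
Hypotheses (r_refl : reflexive r) (r_trans : transitive r) (r_anti : antisymmetric r).
Local Notation T := {D : {set S} | downset r D}.

Lemma ideal_subproof i : downset r [set j | r j i].
Proof. by apply/downsetP => a b; rewrite !inE => rai rba; apply: r_trans rai. Qed.
Definition ideal i : T := exist (fun D => downset r D) _ (ideal_subproof i).

Lemma punctured_ideal_subproof i : downset r [set j | r j i && (j != i)].
Proof.
apply/downsetP => a b; rewrite !inE => /andP[rai nai] rba.
rewrite (r_trans rba rai); apply: contraNneq nai => bi.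
by rewrite (r_anti (x := a) (y := i)) // rai -bi rba.
Qed.
Definition punctured_ideal i : T := exist (fun D => downset r D) _ (punctured_ideal_subproof i).

(** Membership becomes an inclusion between downsets, so it is controlled by a map known only to
    preserve inclusions. *)
Lemma ideal_sub i (D : T) : (val (ideal i) \subset val D) = (i \in val D).
Proof.
apply/fintype.subsetP/idP => [sub|Di j]; first by apply: sub; rewrite inE.
by rewrite inE; have /downsetP := valP D; apply.
Qed.

Variable g : T -> T.
Hypothesis inj_g : injective g.
Hypothesis homo_g : forall D E : T, val D \subset val E -> val (g D) \subset val (g E).

Lemma image_sub (D E : T) : (val (g D) \subset val (g E)) = (val D \subset val E).
Proof.
apply/idP/idP; last exact: homo_g.
exact: (@homo_inj_reflect _ (fun D E : T => val D \subset val E)).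
Qed.

(* [ideal i] is join-irreducible, with [punctured_ideal i] as only lower cover, so
   any element of [g (ideal i)] outside [g (punctured_ideal i)] generates it. *)
Lemma image_ideal i : exists j, g (ideal i) = ideal j.
Proof.
have /fintype.subsetPn[j gj Npj] : ~~ (val (g (ideal i)) \subset val (g (punctured_ideal i))).
  by rewrite image_sub ideal_sub inE eqxx andbF.
exists j; apply: val_inj; apply/eqP; rewrite finset.eqEsubset ideal_sub gj andbT.
pose h := invF inj_g; have gh D : g (h D) = D by apply: f_invF.
rewrite -[ideal j]gh image_sub ideal_sub; apply: contraR Npj => Nhi.
rewrite -ideal_sub -[ideal j]gh image_sub; apply/fintype.subsetP => k hk.
rewrite inE; apply/andP; split; last by apply: contraNneq Nhi => <-.
have : val (h (ideal j)) \subset val (ideal i) by rewrite -image_sub gh ideal_sub.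
by move/fintype.subsetP/(_ _ hk); rewrite inE.
Qed.

(** The map induced by [g] on principal ideals preserves [r], hence is trivial by rigidity, and a
    downset is determined by the principal ideals it contains. *)
Lemma downset_automorphism_id :
  (forall p : S -> S, (forall i j, r (p i) (p j) = r i j) -> p =1 id) -> g =1 id.
Proof.
move=> rigid; have [p gE] := fin_all_exists image_ideal.
have r_ideal i j : r i j = (val (ideal i) \subset val (ideal j)).
  by rewrite ideal_sub inE.
have p_id : p =1 id by apply: rigid => i j; rewrite !r_ideal -!gE image_sub.
move=> D; apply/val_inj/finset.setP => i.
by rewrite -ideal_sub -{1}(p_id i) -gE image_sub ideal_sub.
Qed.

End DownsetAutomorphism.

(* The fence [0 > 1 < 2 > 3 < ...]. *)
Definition fence N : rel 'I_N := fun i j =>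
  (i == j) || odd i && ((val i == (val j).+1) || (val j == (val i).+1)).

Lemma fence_refl N : reflexive (@fence N).
Proof. by move=> i; rewrite /fence eqxx. Qed.

Lemma fence_anti N : antisymmetric (@fence N).
Proof. by move=> i j H; apply: val_inj; move: H; rewrite /fence -!val_eqE /=; lia. Qed.

Lemma fence_trans N : transitive (@fence N).
Proof. by move=> j i k; rewrite /fence -!val_eqE /=; lia. Qed.

(** For even [N] the reversal changes the parity of a position, so it exchanges upper and lower
    elements. *)
Lemma fence_rev N (i j : 'I_N) : ~~ odd N ->
  fence (rev_ord i) (rev_ord j) = fence j i.
Proof.
by move=> evN; rewrite /fence -!val_eqE /=; have := ltn_ord i; have := ltn_ord j; lia.
Qed.

(* When [N] is even, 0 is the only end of the path that is a maximal element, so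
   it is fixed; then so are its successors, one after the other. *)
Lemma fence_rigid N (p : 'I_N -> 'I_N) : ~~ odd N ->
  (forall i j, fence (p i) (p j) = fence i j) -> p =1 id.
Proof.
move=> evN mono_p.
have inj_p : injective p.
  move=> i j pij; apply: fence_anti.
  by rewrite -(mono_p i) -(mono_p j) pij fence_refl.
have surj_p i : exists j, p j = i by exists (invF inj_p i); apply: f_invF.
suff fixp k (i : 'I_N) : i = k :> nat -> p i = i by move=> i; apply: fixp erefl.
elim/ltn_ind: k i => -[|k] IHk i ik.
  have lt1N : (1 < N)%N by have := ltn_ord i; lia.
  have := mono_p (Ordinal lt1N) i; have := @inj_p (Ordinal lt1N) i.
  rewrite /fence -!val_eqE /= ik /= => inj1 le1.
  have evp : ~~ odd (p i).
    have [/val_inj/inj1/(congr1 val)/=|] := eqVneq (val (p (Ordinal lt1N))) (p i).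
      by rewrite ik.
    by move: le1; case: eqP => //=; lia.
  apply/eqP/negPn/negP => Nfix.
  have Nfix' : (p i != 0 :> nat)%N by move: Nfix; rewrite -val_eqE /= ik.
  have below (y : 'I_N) : fence y (p i) -> y != p i -> y = p (Ordinal lt1N).
    have [z <-] := surj_p y; rewrite mono_p (inj_eq inj_p) => le_zi nzi.
    congr p; apply: val_inj; move: le_zi nzi; rewrite /fence -!val_eqE /= ik; lia.
  (* If [p i] were not 0, then, being even in an even fence, it would have two neighbours below it,
     whereas only [p 1] can lie strictly below [p 0]. *)
  have lty : ((p i).-1 < N)%N by have := ltn_ord (p i); lia.
  have ltz : ((p i).+1 < N)%N by have := ltn_ord (p i); lia.
  have := below (Ordinal lty); have := below (Ordinal ltz).
  rewrite /fence -!val_eqE /= => bz by_.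
  have ez := bz ltac:(lia) ltac:(lia); have ey := by_ ltac:(lia) ltac:(lia).
  by have := congr1 val (etrans ey (esym ez)) => /=; lia.
have ltk : (k < N)%N by have := ltn_ord i; lia.
pose j := Ordinal ltk; have pj : p j = j by apply: (IHk k).
have npij : p i != j by rewrite -pj (inj_eq inj_p) -val_eqE /=; lia.
have := mono_p i j; have := mono_p j i; rewrite pj /fence -!val_eqE /=.
move: npij; rewrite -val_eqE /= => npij m1 m2.
have [//|Np] := eqVneq (p i) i.
(* The only neighbour of [k] other than [i] is [k - 1], which by induction is already its own
   image. *)
have pik : (p i).+1 = k by move: Np; rewrite -val_eqE /= ik; lia.
have lti : (p i < k.+1)%N by lia.
by move/inj_p: (IHk _ lti (p i) erefl) Np => ->; rewrite eqxx.
Qed.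

(** * Plane branches with a rational parametrization *)

Section Pullback.
Local Open Scope ring_scope.
Variable R : realType.
Local Notation C := (R[i]).
Implicit Types (p q X Y : {poly C}) (F G : {poly {poly C}}) (f g h : series2 R).

Lemma mul1_coef p q : mul1 (nth 0 p) (nth 0 q) = nth 0 (p * q).
Proof. by apply: funext => k; rewrite coefM. Qed.

Lemma exp1_coef p n : exp1 (nth 0 p) n = nth 0 (p ^+ n).
Proof.
elim: n => [|n IHn]; first by apply: funext => k; rewrite expr0 coef1.
by rewrite exprS -mul1_coef -IHn.
Qed.

Lemma pullback_coef X Y f k : pullback (nth 0 X) (nth 0 Y) f k =
  \sum_(i < k.+1) \sum_(j < k.+1) f i j * (X ^+ i * Y ^+ j)`_k.
Proof.
by apply: eq_bigr => i _; apply: eq_bigr => j _; rewrite !exp1_coef mul1_coef.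
Qed.

Lemma coef_mul_small p q a b : (forall k, (k < a)%N -> p`_k = 0) ->
  (forall k, (k < b)%N -> q`_k = 0) ->
  forall k, (k < a + b)%N -> (p * q)`_k = 0.
Proof.
move=> p0 q0 k lt_k; rewrite coefM big1 // => i _.
have [/p0->|le_ai] := ltnP i a; first by rewrite mul0r.
by rewrite q0 ?mulr0 //; have := ltn_ord i; lia.
Qed.

Lemma coef_exp_small p n : p`_0 = 0 -> forall k, (k < n)%N -> (p ^+ n)`_k = 0.
Proof.
move=> p0; elim: n => // n IHn k lt_k; rewrite exprS.
by apply: (@coef_mul_small _ _ 1 n) => // -[].
Qed.

Lemma coef_monomial_small X Y i j k : X`_0 = 0 -> Y`_0 = 0 -> (k < i + j)%N ->
  (X ^+ i * Y ^+ j)`_k = 0.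
Proof. by move=> X0 Y0; apply: coef_mul_small; apply: coef_exp_small. Qed.

(** The inner variable is x and the outer one y, hence the order of the indices. *)
Definition coefs2 F : series2 R := fun i j => F`_j`_i.
Definition eval2 X Y F : {poly C} := (map_poly (comp_poly X) F).[Y].

Lemma eval2M X Y F G : eval2 X Y (F * G) = eval2 X Y F * eval2 X Y G.
Proof. by rewrite /eval2 rmorphM hornerM. Qed.

Lemma eval2E X Y F N : (size F <= N)%N -> (forall j, (size (F`_j)%R <= N)%N) ->
  eval2 X Y F = \sum_(i < N) \sum_(j < N) F`_j`_i *: (X ^+ i * Y ^+ j).
Proof.
move=> leF leFj; rewrite /eval2 (@horner_coef_wide _ N); last first.
  exact: leq_trans (size_poly _ _) leF.
rewrite exchange_big; apply: eq_bigr => j _ /=.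
rewrite coef_map /= comp_polyE mulr_suml.
rewrite (big_ord_widen N (fun i => F`_j`_i *: X ^+ i * Y ^+ j)) //.
rewrite big_mkcond /=; apply: eq_bigr => i _; rewrite scalerAl.
by case: ltnP => // le_i; rewrite nth_default ?scale0r ?mul0r.
Qed.

Lemma sum_square_widen (a : nat -> nat -> C) k N : (k <= N)%N ->
  (forall i j, (k <= i)%N || (k <= j)%N -> a i j = 0) ->
  \sum_(i < N) \sum_(j < N) a i j = \sum_(i < k) \sum_(j < k) a i j.
Proof.
move=> le_kN a0.
rewrite [RHS](big_ord_widen N (fun i => \sum_(j < k) a i j) le_kN).
rewrite [RHS]big_mkcond /=; apply: eq_bigr => i _.
case: ltnP => [_|le_i]; last by rewrite big1 // => j _; rewrite a0 ?le_i.
rewrite (big_ord_widen N (a i) le_kN) [RHS]big_mkcond /=; apply: eq_bigr => j _.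
by case: ltnP => // le_j; rewrite a0 ?le_j ?orbT.
Qed.

Lemma size_bound F :
  exists N, (size F <= N)%N /\ forall j, (size (F`_j)%R <= N)%N.
Proof.
exists (maxn (size F) (\max_(j < size F) size (F`_j)%R)); split.
  exact: leq_maxl.
move=> j; have [lt_j|le_j] := ltnP j (size F); last by rewrite nth_default ?size_poly0.
by rewrite leq_max orbC (leq_bigmax (Ordinal lt_j)).
Qed.

(** The monomials left out of the truncated sum have order greater than [k], because [X] and [Y]
    have no constant term. *)
Lemma pullback_eval2 X Y F : X`_0 = 0 -> Y`_0 = 0 ->
  pullback (nth 0 X) (nth 0 Y) (coefs2 F) = nth 0 (eval2 X Y F).
Proof.
move=> X0 Y0; apply: funext => k; have [N [leF leFj]] := size_bound F.
rewrite pullback_coef (@eval2E _ _ _ (maxn N k.+1)); first last.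
- by move=> j; rewrite leq_max leFj.
- by rewrite leq_max leF.
rewrite coef_sum -(@sum_square_widen
  (fun i j => coefs2 F i j * (X ^+ i * Y ^+ j)`_k) k.+1 (maxn N k.+1)) ?leq_maxr //.
  apply: eq_bigr => i _; rewrite coef_sum; apply: eq_bigr => j _.
  by rewrite coefZ.
by move=> i j lt_k; rewrite coef_monomial_small ?mulr0 //; lia.
Qed.

Lemma pullback_ext x y f g k :
  (forall i j, (i <= k)%N -> (j <= k)%N -> f i j = g i j) ->
  pullback (R := R) x y f k = pullback x y g k.
Proof.
by move=> fg; apply: eq_bigr => i _; apply: eq_bigr => j _;
  rewrite fg // -ltnS.
Qed.

(** A coefficient of a pullback involves finitely many coefficients of the series, so identities on
    series reduce to polynomials. *)
Definition trunc2 N f : {poly {poly C}} := \poly_(j < N) \poly_(i < N) f i j.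

Lemma coefs2_trunc2 N f i j : (i < N)%N -> (j < N)%N ->
  coefs2 (trunc2 N f) i j = f i j.
Proof. by move=> lt_i lt_j; rewrite /coefs2 !coef_poly lt_j coef_poly lt_i. Qed.

Lemma coefs2M F G : coefs2 (F * G) = mul2 (coefs2 F) (coefs2 G).
Proof.
apply: funext => i; apply: funext => j; rewrite /coefs2 coefM coef_sum.
under eq_bigr => l _ do rewrite coefM.
by rewrite exchange_big.
Qed.

Lemma pullbackM X Y g h : X`_0 = 0 -> Y`_0 = 0 ->
  pullback (nth 0 X) (nth 0 Y) (mul2 g h) =
  mul1 (pullback (nth 0 X) (nth 0 Y) g) (pullback (nth 0 X) (nth 0 Y) h).
Proof.
move=> X0 Y0; apply: funext => k.
pose G := trunc2 k.+1 g; pose H := trunc2 k.+1 h.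
have eq_tr f l : (l <= k)%N ->
    pullback (nth 0 X) (nth 0 Y) f l = (eval2 X Y (trunc2 k.+1 f))`_l.
  move=> le_l; rewrite -pullback_eval2 //; apply: pullback_ext => i j le_i le_j.
  by rewrite coefs2_trunc2 // ltnS; lia.
rewrite (@pullback_ext _ _ _ (coefs2 (G * H))); last first.
  move=> i j le_i le_j; rewrite coefs2M; apply: eq_bigr => a _.
  by apply: eq_bigr => b _; rewrite !coefs2_trunc2 //; have := ltn_ord a;
    have := ltn_ord b; lia.
rewrite pullback_eval2 // eval2M coefM; apply: eq_bigr => a _.
by rewrite !eq_tr ?leq_subr // -ltnS.
Qed.

Lemma mul1_eq0 (a b : series1 R) : (forall k, mul1 a b k = 0) ->
  (forall k, a k = 0) \/ (forall k, b k = 0).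
Proof.
move=> ab0; case: (pselect (exists k, a k != 0)) => [exa|Na]; last first.
  by left=> k; apply/eqP; apply: contrapT => /negP ak; apply: Na; exists k.
case: (pselect (exists k, b k != 0)) => [exb|Nb]; last first.
  by right=> k; apply/eqP; apply: contrapT => /negP ak; apply: Nb; exists k.
case: (ex_minnP exa) => i ai mina; case: (ex_minnP exb) => j bj minb.
(* At index [i + j] only the product of the two lowest nonzero coefficients survives. *)
have := ab0 (i + j)%N; rewrite /mul1.
have lt_i : (i < (i + j).+1)%N by lia.
rewrite (bigD1 (Ordinal lt_i)) //= big1 => [|l nel]; last first.
  have [/eqP->|al] := boolP (a l == 0); first by rewrite mul0r.
  have [/eqP->|bl] := boolP (b (i + j - l)%N == 0); first by rewrite mulr0.
  have := mina _ al; have := minb _ bl; have := ltn_ord l; move: nel; rewrite -val_eqE /=; lia.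
by rewrite addr0 addKn => /eqP; rewrite mulf_eq0 (negPf ai) (negPf bj).
Qed.

Lemma le_sum_square_widen (a : nat -> nat -> C) k N : (forall i j, 0 <= a i j) ->
  (forall i j, (k <= i)%N || (k <= j)%N -> a i j = 0) ->
  \sum_(i < N) \sum_(j < N) a i j <= \sum_(i < k) \sum_(j < k) a i j.
Proof.
move=> a_ge0 a0; pose m := maxn k N.
rewrite -(@sum_square_widen _ k m) ?leq_maxl //.
pose b i j := if (i < N)%N && (j < N)%N then a i j else 0.
have -> : \sum_(i < N) \sum_(j < N) a i j = \sum_(i < m) \sum_(j < m) b i j.
  rewrite (@sum_square_widen _ N m) ?leq_maxr //; last first.
    by move=> i j; rewrite /b !ltnNge -negb_or => ->.
  by apply: eq_bigr => i _; apply: eq_bigr => j _; rewrite /b !ltn_ord.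
apply: ler_sum => i _; apply: ler_sum => j _.
by rewrite /b; case: ifP => // _; apply: a_ge0.
Qed.

Lemma convergent2_coefs2 F : convergent2 (coefs2 F).
Proof.
have [k [leF leFj]] := size_bound F.
exists 1, (complex.Re (\sum_(i < k) \sum_(j < k) `|coefs2 F i j|)); split=> // N.
rewrite RRe_real; last first.
  by apply: sum_real => i _; apply: sum_real => j _; apply: normr_real.
under eq_bigr => i _ do under eq_bigr => j _ do rewrite rmorph1 expr1n mulr1.
apply: (@le_sum_square_widen (fun i j => `|coefs2 F i j|)) => // i j ge_k.
rewrite /coefs2; have [lt_j|le_j] := ltnP j k.
  have le_i : (size (F`_j)%R <= i)%N by have := leFj j; lia.
  by rewrite (nth_default _ le_i) normr0.
by rewrite (nth_default _ (leq_trans leF le_j)) coef0 normr0.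
Qed.

Lemma convergent1_coef p : convergent1 (nth 0 p).
Proof.
have [rho [M [rho_gt0 leM]]] := convergent2_coefs2 p%:P.
exists rho, M; split=> // -[|N]; first by have := leM 0%N; rewrite !big_ord0.
have := leM N.+1; congr (_ <= _); apply: eq_bigr => i _.
rewrite big_ord_recl /= big1 ?addr0 => [|j _].
  by rewrite /coefs2 coefC addn0.
by rewrite /coefs2 coefC /= coef0 normr0 mul0r.
Qed.

(* Among the [N^2] monomials [X^i Y^j] with [i, j < N], all of degree [O(N)],
   there is a linear relation as soon as [N] is large. *)
Lemma algebraic_relation X Y : exists2 F, F != 0 & eval2 X Y F = 0.
Proof.
(* With this [N], the [N ^ 2] monomials outnumber the [D = 2 a N + 1] coefficients that each may
   have; a vector of the left kernel of [M] is a relation. *)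
pose a := maxn (size X) (size Y); pose N := (2 * a).+2.
pose I : finType := ('I_N * 'I_N)%type; pose D := (N * (2 * a)).+1.
pose M : 'M[C]_(#|{: I}|, D) :=
  \matrix_(r < #|{: I}|) poly_rV (X ^+ (@enum_val I predT r).1 * Y ^+ (@enum_val I predT r).2).
have sizeM (i j : 'I_N) : (size (X ^+ i * Y ^+ j)%R <= D)%N.
  rewrite (leq_trans (size_polyMleq _ _)) //.
  have := size_poly_exp_leq X i; have := size_poly_exp_leq Y j.
  have := ltn_ord i; have := ltn_ord j.
  have : (size X <= a)%N by rewrite leq_maxl.
  have : (size Y <= a)%N by rewrite leq_maxr.
  rewrite /D; nia.
have : kermx M != 0.
  rewrite -mxrank_eq0 mxrank_ker -lt0n subn_gt0.
  rewrite (leq_ltn_trans (rank_leq_col M)) //.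
  by rewrite card_prod card_ord /D /N; nia.
case/rowV0Pn => u /sub_kermxP uM0 /rV0Pn[r /negP ur].
pose F : {poly {poly C}} := \poly_(j < N) \poly_(i < N) u 0 (enum_rank (inord i, inord j)).
have coefF (i j : 'I_N) : F`_j`_i = u 0 (enum_rank (i, j)).
  by rewrite !coef_poly ltn_ord coef_poly ltn_ord !inord_val.
exists F.
  apply/eqP => F0; apply: ur; have := coefF (@enum_val I predT r).1 (@enum_val I predT r).2.
  by rewrite F0 !coef0 -surjective_pairing enum_valK => <-.
rewrite (@eval2E _ _ _ N) ?size_poly //; last first.
  by move=> j; rewrite coef_poly; case: ifP; rewrite ?size_poly ?size_poly0.
set E := \sum_(i < N) _.
have size_E : (size E <= D)%N.
  do 2![rewrite (leq_trans (size_sum _ _ _)) //; apply/bigmax_leqP=> ? _].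
  exact: leq_trans (size_scale_leq _ _) (sizeM _ _).
suff E0 : poly_rV E = 0 :> 'rV_D by rewrite -(poly_rV_K size_E) E0 linear0.
rewrite -{}uM0 mulmx_sum_row (reindex enum_rank) /=; last first.
  by exists enum_val => i _; rewrite ?enum_rankK ?enum_valK.
rewrite /E pair_bigA /= raddf_sum; apply: eq_bigr => -[i j] _.
by rewrite /= linearZ rowK enum_rankK coefF.
Qed.

(* A nonzero element of least order in the kernel of [pullback] is irreducible:
   [C{t}] being a domain, one of two nonunit factors would lie in the kernel and
   have smaller order. *)
Lemma plane_branch_exists X Y : X`_0 = 0 -> Y`_0 = 0 ->
  exists f, plane_branch f /\ forall k, pullback (nth 0 X) (nth 0 Y) f k = 0.
Proof.
move=> X0 Y0; pose ker f := forall k, pullback (nth 0 X) (nth 0 Y) f k = 0.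
pose ordle d := `[< exists f, [/\ convergent2 f, ker f &
  exists i j, (i + j = d)%N /\ f i j != 0] >].
have exd : exists d, ordle d.
  have [F nzF evF0] := algebraic_relation X Y.
  have [j nzFj] : exists j, F`_j != 0.
    by exists (size F).-1; rewrite -lead_coefE lead_coef_eq0.
  have [i nzFij] : exists i, F`_j`_i != 0.
    by exists (size (F`_j)%R).-1; rewrite -lead_coefE lead_coef_eq0.
  exists (i + j)%N; apply/asboolP; exists (coefs2 F); split.
  - exact: convergent2_coefs2.
  - by move=> k; rewrite pullback_eval2 // evF0 coef0.
  - by exists i, j.
case: (ex_minnP exd) => d /asboolP[f [cvf kerf [i [j [ijd nzf]]]]] mind.
have low g : convergent2 g -> ker g ->
    forall k l, (k + l < d)%N -> g k l = 0.
  move=> cvg kerg k l lt_d; apply/eqP; apply: contraLR lt_d => nzg.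
  by rewrite -leqNgt mind //; apply/asboolP; exists g; split=> //; exists k, l.
exists f; split=> //; split=> //.
- have := kerf 0%N; rewrite pullback_coef !big_ord1 !expr0 mulr1 coef1 mulr1.
  by [].
- by exists i, j.
move=> g h cvg cvh fE; apply: contrapT => /not_orP[/negP/negPn/eqP g0].
move=> /negP/negPn/eqP h0.
have fgh : f = mul2 g h by apply: funext => k; apply: funext => l.
have kerM : forall k, mul1 (pullback (nth 0 X) (nth 0 Y) g)
    (pullback (nth 0 X) (nth 0 Y) h) k = 0.
  by move=> k; rewrite -pullbackM // -fgh kerf.
case/negP: nzf; rewrite fE /mul2; apply/eqP.
rewrite big1 // => k _; rewrite big1 // => l _.
(* Each term of the coefficient of x^i y^j in the product vanishes: a factor in the kernel has no
   coefficient of total degree below [d], and the extreme terms contain a zero constant term. *)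
have [lt_kl|ge_kl] := ltnP (k + l) (i + j).
  have [kerg|kerh] := mul1_eq0 kerM; first by rewrite low ?mul0r // -ijd.
  have [/eqP kl0|kl_gt0] := eqVneq (k + l)%N 0%N.
    by move: kl0; rewrite addn_eq0 => /andP[/eqP-> /eqP->]; rewrite g0 mul0r.
  by rewrite (low h) ?mulr0 // -ijd; have := ltn_ord k; have := ltn_ord l; lia.
have [-> ->] : (i - k = 0 /\ j - l = 0)%N.
  by have := ltn_ord k; have := ltn_ord l; lia.
by rewrite h0 mulr0.
Qed.

(** [p] is a quotient of two polynomials in [X] and [Y]; for [p = t] this gives the birationality
    required of a normalization. *)
Definition rational_in X Y p : Prop :=
  exists G H, eval2 X Y H != 0 /\ eval2 X Y H * p = eval2 X Y G.

Lemma rational_in_inner X Y : rational_in X Y X.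
Proof.
exists ('X%:P), 1; rewrite /eval2 rmorph1 hornerC oner_neq0 mul1r.
by rewrite map_polyC /= hornerC comp_polyX.
Qed.

Lemma rational_in_outer X Y : rational_in X Y Y.
Proof.
exists 'X, 1; rewrite /eval2 rmorph1 hornerC oner_neq0 mul1r.
by rewrite map_polyX hornerX.
Qed.

Lemma rational_in_div X Y p q r : rational_in X Y p -> rational_in X Y r ->
  p != 0 -> p * q = r -> rational_in X Y q.
Proof.
move=> [G [H [nzH HpG]]] [G' [H' [nzH' HrG]]] nzp pqr.
exists (H * G'), (H' * G); rewrite !eval2M -HpG -HrG -pqr.
by rewrite !mulf_neq0 //; split=> //; rewrite mulrCA -!mulrA; congr (_ * _);
  rewrite mulrCA.
Qed.

Lemma rational_in_subZ X Y p q (c : C) : rational_in X Y p ->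
  rational_in X Y q -> rational_in X Y (q - c *: p).
Proof.
move=> [G [H [nzH HpG]]] [G' [H' [nzH' HqG]]].
exists (H * G' - c%:P%:P * H' * G), (H * H'); rewrite !eval2M mulf_neq0 //.
split=> //; rewrite /eval2 rmorphB hornerD hornerN -!/(eval2 _ _ _) !eval2M.
rewrite -HpG -HqG /eval2 map_polyC hornerC /= comp_polyC -mul_polyC.
by ring.
Qed.

Lemma normalization_exists X Y : X`_0 = 0 -> Y`_0 = 0 ->
  rational_in X Y 'X ->
  exists f, plane_branch f /\ normalization f (nth 0 X) (nth 0 Y).
Proof.
move=> X0 Y0 [G [H [nzH HG]]].
have [f [brf kerf]] := plane_branch_exists X0 Y0; exists f; split=> //.
split=> //; first by split; apply: convergent1_coef.
exists (coefs2 G), (coefs2 H); split.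
- exact: convergent2_coefs2.
- exact: convergent2_coefs2.
- rewrite pullback_eval2 //; exists (size (eval2 X Y H)).-1.
  by rewrite -lead_coefE lead_coef_eq0.
- by move=> k; rewrite !pullback_eval2 // -HG coefMX; case: k.
Qed.

End Pullback.

(** * Blow-ups and realization of the diagrams *)

Section Realization.
Local Open Scope ring_scope.
Variable R : realType.
Local Notation C := (R[i]).
Implicit Types (q : nat -> option C).

Lemma mul1_coef1 (a b : series1 R) : mul1 a b 1%N = a 0%N * b 1%N + a 1%N * b 0%N.
Proof. by rewrite /mul1 !big_ord_recl big_ord0 addr0. Qed.

(** Normal crossings persist, so minimality of a resolution need only be tested at the last point
    blown up. *)
Lemma normal_crossing_blow_up k c (P Q : near_point R) :
  normal_crossing P -> blow_up k c P Q -> normal_crossing Q.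
Proof.
move=> [smooth one ax ay] [x0 [y0]]; case: c => [c|].
  case=> pxQ pyP axQ ayQ.
  have py1 : py P 1%N = px P 1%N * c.
    by rewrite -pyP mul1_coef1 -!pxQ x0 mul0r add0r /= y0 add0r.
  have nz1 : px P 1%N != 0.
    by case: smooth => //; rewrite py1; apply: contraNneq => ->; rewrite mul0r.
  have ayQN : axis_y Q = None.
    rewrite ayQ; case: eqP => // c0; case: (axis_y P) ay => // i.
    by rewrite py1 c0 mulr0 eqxx => ay; have := ay ltac:(by []).
  by split; rewrite ?ayQN ?pxQ //; [left | right].
case=> pyQ pxP axQ ayQ.
have px1 : px P 1%N = 0.
  by rewrite -pxP mul1_coef1 -!pyQ x0 y0 mul0r mulr0 addr0.
have axQN : axis_x Q = None.
  by rewrite axQ; case: (axis_x P) ax => // i; rewrite px1 eqxx => ax; have := ax ltac:(by []).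
have nz1 : py P 1%N != 0 by case: smooth; rewrite // px1 eqxx.
by split; rewrite ?axQN ?pyQ //; [right | left].
Qed.

Definition blow_down (c : option C) (P : {poly C} * {poly C}) :=
  match c with
  | Some c => (P.1, P.1 * (P.2 + c%:P))
  | None => (P.1 * P.2, P.2)
  end.

(* The lift to the [k]-th model of the normalization, when [m] more points are to
   be blown up. *)
Fixpoint branch_lift q m k : {poly C} * {poly C} :=
  if m is m'.+1 then blow_down (q k) (branch_lift q m' k.+1) else ('X, 'X).

Fixpoint axes q k : option nat * option nat :=
  if k is k'.+1 then
    match q k' with
    | Some c => (Some k', if c == 0 then (axes q k').2 else None)
    | None => ((axes q k').1, Some k')
    end
  else (None, None).

Definition branch_point q n k : near_point R :=
  let P := branch_lift q (n - k) k in
  NearPoint (nth 0 P.1) (nth 0 P.2) (axes q k).1 (axes q k).2.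

Lemma lift_prop q m k : let P := branch_lift q m k in
  [/\ P.1`_0 = 0, P.2`_0 = 0, P.1 != 0 & P.2 != 0].
Proof.
elim: m k => [|m IHm] k /=; first by rewrite coefX polyX_eq0.
case: (IHm k.+1); set P := branch_lift _ _ _ => x0 y0 nzx nzy.
case: (q k) => [c|] /=; rewrite !coef0M ?x0 ?mul0r ?mulf_neq0 //.
have [->|nzc] := eqVneq c 0; first by rewrite addr0.
apply: contra_neq nzc => /(congr1 (fun p : {poly C} => p`_0)).
by rewrite coefD coefC y0 add0r coef0.
Qed.

Lemma lift_step q n k : (k < n)%N ->
  branch_lift q (n - k) k = blow_down (q k) (branch_lift q (n - k.+1) k.+1).
Proof. by move=> lt_kn; rewrite -subnSK. Qed.

Lemma add_const_coef (c : C) (p : {poly C}) : add_const c (nth 0 p) = nth 0 (p + c%:P).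
Proof.
by apply: funext => -[|k]; rewrite /add_const coefD coefC //= addr0.
Qed.

Lemma blow_up_branch_point q n k : (k < n)%N ->
  blow_up k (q k) (branch_point q n k) (branch_point q n k.+1).
Proof.
move=> lt_kn; have [x0 y0 _ _] := lift_prop q (n - k.+1) k.+1.
split=> //; split=> //; rewrite /branch_point /= (lift_step _ lt_kn).
case: (q k) => [c|] //=; split=> // i; last by rewrite mul1_coef.
by rewrite add_const_coef mul1_coef.
Qed.

(** Each blow-up replaces a coordinate by a quotient, up to a constant; at level [n] the parameter t
    itself is reached. *)
Lemma rational_in_lift q n k (P0 := branch_lift q n 0) : (k <= n)%N ->
  rational_in P0.1 P0.2 (branch_lift q (n - k) k).1 /\
  rational_in P0.1 P0.2 (branch_lift q (n - k) k).2.
Proof.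
elim: k => [|k IHk] lt_kn.
  by rewrite subn0; split; [apply: rational_in_inner | apply: rational_in_outer].
have [] := IHk (ltnW lt_kn); rewrite (lift_step _ lt_kn).
have [_ _] := lift_prop q (n - k.+1) k.+1.
case: (q k) => [c|] /=; set P := branch_lift _ _ _ => nzx nzy rx ry; split=> //.
  apply: (rational_in_div rx (rational_in_subZ c rx ry) nzx).
  by rewrite -mul_polyC; ring.
by apply: (rational_in_div ry rx nzy); rewrite mulrC.
Qed.

(** [P_(n-1)] is a crossing of two exceptional curves, hence must be blown up; the direction 1 then
    leaves both of them, so that [P_n] lies on [E(P_(n-1))] only. *)
Lemma resolution_exists q n : (0 < n)%N -> q n.-1 = Some 1 ->
  (axes q n.-1).1 != None -> (axes q n.-1).2 != None ->
  exists f, plane_branch f /\ minimal_resolution f n (branch_point q n).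
Proof.
move=> n_gt0 qn satx saty.
have [x0 y0 _ _] := lift_prop q n 0.
have [] := rational_in_lift q (leqnn n); rewrite subnn => ratX _.
have [f [brf normf]] := normalization_exists x0 y0 ratX.
exists f; split=> //; split.
- by eexists; eexists; split; [exact: normf | rewrite /branch_point subn0].
- by move=> k lt_kn; exists (q k); apply: blow_up_branch_point.
- move=> k lt_kn nck.
  have nc m : (k <= m < n)%N -> normal_crossing (branch_point q n m).
    elim: m => [|m IHm]; first by rewrite leqn0 => /andP[/eqP <-].
    rewrite leq_eqVlt ltnS => /andP[/orP[/eqP <- //|le_km] lt_mn].
    have := blow_up_branch_point q (ltnW lt_mn); apply: normal_crossing_blow_up.
    by apply: IHm; rewrite le_km ltnW.
  have [] := nc n.-1; first lia.
  by move=> _ [] /= ax; rewrite ?ax in satx saty.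
- rewrite /normal_crossing /branch_point subnn /= !coefX oner_neq0.
  have -> : axes q n = (Some n.-1, None).
    by rewrite -{1}(prednK n_gt0) /= qn oner_eq0.
  by split=> //; [left | right].
Qed.

(** * Directions and proximity relations read off a diagram *)

Section Directions.
Variables st br : nat -> bool.

(* With [st k] for "[e_k] is straight" and [br k] for "[v_k] is breaking",
   [direction k] is the direction at [P_k] of [P_(k+1)]. If [e_(k+1)] is curved,
   1 gives a free point. Otherwise [P_(k+1)] must be on one of the axes: the older
   one if the straight path goes on through [v_k], that of [E(P_(k-1))] else. *)
Fixpoint direction k : option C :=
  if k is k'.+1 then
    if ~~ st k.+1 then Some 1 else
    if isSome (direction k') == (st k && ~~ br k) then Some 0 else None
  else Some 1.

(* The index [i < k - 1], if any, such that [P_k] is proximate to [P_i]. *)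
Fixpoint older k : option nat :=
  if k is k'.+1 then
    if ~~ st k then None else
    if st k' && ~~ br k' then older k' else Some k'.-1
  else None.

(** The chart chosen at [P_k] decides which axis is [E(P_k)]; the other axis obeys the recursion of
    [older]. *)
Lemma axes_direction k : st 1%N = false -> axes direction k.+1 =
  if direction k is Some _ then (Some k, older k.+1) else (older k.+1, Some k).
Proof.
move=> st1; elim: k => [|k IHk]; first by rewrite /= oner_eq0 st1.
rewrite [axes _ _]/= -/(axes _ k.+1) IHk.
rewrite [direction k.+1]/= [older k.+2]/=.
case: (st k.+2) => /=; last by rewrite oner_eq0.
by case: (st k.+1 && _) IHk; case: (direction k) => [c|] _ //=; rewrite eqxx.
Qed.

(** The conditions say that the path from v_(i+1) to v_k is straight and cannot be extended
    backwards: e_(i+1) is curved or v_(i+1) is breaking. *)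
Lemma olderP k i : st 1%N = false -> older k = Some i <->
  [/\ (i.+2 <= k)%N, forall m, (i.+2 <= m <= k)%N -> st m,
      forall m, (i.+2 <= m < k)%N -> ~~ br m & ~~ st i.+1 || br i.+1].
Proof.
move=> st1; elim: k => [|k IHk]; first by split=> // -[].
rewrite /=; case: ifPn => [/negPf Nst|/negPn stk].
  by split=> // -[lt_i /(_ k.+1)]; rewrite lt_i leqnn Nst => /(_ isT).
case: ifPn => [/andP[stk' Nbr]|turn].
  rewrite IHk; split=> -[lt_i sti bri turn].
    split=> //; first exact: leqW.
    - move=> m /andP[le_im]; rewrite leq_eqVlt => /predU1P[-> //|lt_mk].
      by apply: sti; rewrite le_im.
    - move=> m /andP[le_im]; rewrite ltnS leq_eqVlt => /predU1P[-> //|lt_mk].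
      by apply: bri; rewrite le_im.
  have lt_ik : (i.+2 <= k)%N.
    move: lt_i; rewrite leq_eqVlt => /predU1P[[ik]|//].
    by move: turn; rewrite ik stk' (negPf Nbr).
  by split=> // m /andP[le_im lt_mk]; [apply: sti | apply: bri]; lia.
(* Since e_1 is curved, a straight edge e_(k+1) has [k > 0], so [k.-1] is a genuine index. *)
case: k stk turn IHk => [|k] stk turn _; first by rewrite stk in st1.
split=> [[<-]|[lt_i sti bri _]].
  split=> //; try by move=> m lt_m; have -> : m = k.+2 by lia.
    by move=> m; lia.
  by move: turn; rewrite negb_and negbK.
move: lt_i; rewrite ltnS leq_eqVlt => /predU1P[[->]//|lt_ik].
by move: turn; rewrite sti ?bri //; lia.
Qed.

Lemma older_None k : (forall m, st m -> (1 < m)%N) ->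
  (older k == None) = ~~ st k.
Proof.
move=> st_gt1; elim: k => [|k IHk]; first by case: (boolP (st 0%N)) => // /st_gt1.
by rewrite /=; case: (st k.+1) => //=; case: ifP => // /andP[stk _]; rewrite IHk stk.
Qed.

Lemma proximate_direction n k i : st 1%N = false ->
  proximate (branch_point direction n) k i <->
  (0 < k)%N /\ (i = k.-1 \/ older k = Some i).
Proof.
move=> st1; case: k => [|k]; first by split=> [[]|[]].
rewrite /proximate /branch_point [axis_x _]/= [axis_y _]/= -/(axes _ k.+1).
rewrite axes_direction //; case: (direction k) => [c|] /=.
  by split=> [[[->]|]|[_ [->|]]]; auto.
by split=> [[|[->]]|[_ [->|]]]; auto.
Qed.

End Directions.

(** * Realization of the decorations satisfying the combinatorial conditions *)

Definition mem_nat n (A : {set 'I_n}) (k : nat) : bool :=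
  [exists j, (j \in A) && (val j == k)].

Lemma mem_natE n (A : {set 'I_n}) (j : 'I_n) : mem_nat A j = (j \in A).
Proof.
apply/existsP/idP => [[i /andP[Ai /eqP/val_inj <- //]]|Aj].
by exists j; rewrite Aj eqxx.
Qed.

Lemma mem_nat_ltn n (A : {set 'I_n}) k : mem_nat A k -> (k < n)%N.
Proof. by case/existsP => i /andP[_ /eqP <-]; apply: ltn_ord. Qed.

Lemma eq_mem_nat n (A B : {set 'I_n}) : mem_nat A =1 mem_nat B -> A = B.
Proof. by move=> AB; apply/finset.setP => j; rewrite -!mem_natE. Qed.

(** These conditions also force v_0, v_1 and v_(n-1) to be neutral, since e_1 is not straight and
    there is no e_n. *)
Definition admissible n (d : decoration n) : Prop :=
  [/\ forall k, mem_nat (straight d) k -> (1 < k)%N,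
      mem_nat (straight d) n.-1
    & forall k, mem_nat (breaking d) k -> mem_nat (straight d) k && mem_nat (straight d) k.+1].

Lemma straight_pathP n (d : decoration n) a b : (b < n)%N ->
  straight_path d a b <->
  (forall m, (a < m <= b)%N -> mem_nat (straight d) m) /\
  (forall m, (a < m < b)%N -> ~~ mem_nat (breaking d) m).
Proof.
move=> lt_bn; split=> -[std brd]; split=> m lt_m.
- have lt_mn : (m < n)%N by lia.
  by have := std (Ordinal lt_mn) lt_m; rewrite -mem_natE.
- have lt_mn : (m < n)%N by lia.
  by have := brd (Ordinal lt_mn) lt_m; rewrite -mem_natE.
- by rewrite -mem_natE std.
- by rewrite -mem_natE brd.
Qed.

Lemma admissible_enriques n (d : decoration n) : (3 <= n)%N ->
  admissible d -> enriques R n d.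
Proof.
move=> n_ge3 [st_gt1 st_last br_st].
set st := mem_nat (straight d) in st_gt1 st_last br_st.
set br := mem_nat (breaking d) in br_st.
have st1 : st 1%N = false by apply/negbTE/negP => /st_gt1.
have stn : st n = false by apply/negbTE/negP => /mem_nat_ltn; rewrite ltnn.
pose q := direction st br; pose o := older st br.
have prox k i : proximate (branch_point q n) k i <->
    (0 < k)%N /\ (i = k.-1 \/ o k = Some i) by apply: proximate_direction.
have oP k i : o k = Some i <->
  [/\ (i.+2 <= k)%N, forall m, (i.+2 <= m <= k)%N -> st m,
      forall m, (i.+2 <= m < k)%N -> ~~ br m & ~~ st i.+1 || br i.+1].
  exact: olderP.
have oN k : (o k == None) = ~~ st k by apply: older_None.
(* There is no edge e_n, so [st n] is false and the last direction is the generic one. *)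
have qn : q n.-1 = Some 1.
  have -> : n.-1 = n.-2.+1 by lia.
  by rewrite /q /= (_ : n.-2.+2 = n) ?stn //; lia.
have n2 : n.-1 = n.-2.+1 by lia.
have axn := axes_direction br n.-2 st1; rewrite -n2 -/(q _) -/(o _) in axn.
have on1 : o n.-1 != None by rewrite oN negbK.
have [||||f [brf resf]] := @resolution_exists q n; first lia; first exact: qn.
- by rewrite axn; case: (q _).
- by rewrite axn; case: (q _).
exists f, (branch_point q n); split=> //.
have run_older i k : proximate_run n (branch_point q n) i k -> (i.+2 <= k)%N ->
    o k = Some i.
  move=> [lt_kn run] lt_ik; have [prk _] := run k lt_kn.
  by have [|_ []//] := (prox k i).1 ((run k lt_kn).2 _); lia.
split=> [j|i k run lt_ik|j].
- rewrite -mem_natE -/st; split=> [stj|[j_gt0 nfree]].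
    have j_gt1 := st_gt1 _ stj; split; first exact: ltnW.
    have : o j != None by rewrite oN negbK.
    case oj: (o j) => [i|] // _ [i0 [_ uniq]]; have [lt_i _ _ _] := (oP _ _).1 oj.
    have := uniq _ ((prox j i).2 (conj (ltnW j_gt1) (or_intror oj))).
    have := uniq _ ((prox j j.-1).2 (conj (ltnW j_gt1) (or_introl erefl))).
    lia.
  apply: contrapT => /negP; rewrite -oN => /eqP oj; apply: nfree; exists j.-1.
  split; first by apply/prox; split=> //; left.
  by move=> i /prox[_ []//]; rewrite oj.
- have ok := run_older _ _ run lt_ik; have [_ sti bri turn] := (oP _ _).1 ok.
  have [lt_kn runk] := run.
  split; first by apply/straight_pathP => //; split.
  + move=> _ /(straight_pathP _ _ lt_kn)[st' br'].
    move: turn; rewrite /st /br st' /=; last lia.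
    by rewrite (negPf (br' _ _)) //; lia.
  + move=> lt_k1n /(straight_pathP _ _ lt_k1n)[st' br'].
    have pr : proximate (branch_point q n) k.+1 i.
      by apply/prox; split=> //; right; apply/oP; split=> //; exact: leqW.
    by have := (runk _ lt_k1n).1 pr; lia.
- rewrite -mem_natE -/br -mem_natE -/st; split=> [brj|[i [k [run lt_ik ji stj]]]].
    have /andP[stj stj1] := br_st _ brj; have j_gt1 := st_gt1 _ stj.
    pose i := j.-1; have ij : j = i.+1 :> nat by lia.
    (* [P_(j+1)] is proximate to [P_i]; the largest such index ends the run of points proximate to
       [P_i]. *)
    have ex : exists k, (k < n)%N && (o k == Some i).
      exists j.+1; rewrite (mem_nat_ltn stj1); apply/eqP/oP; split; try lia.
      + by move=> m lt_m; have -> : m = j.+1 by lia.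
      + by rewrite -ij brj orbT.
    have bnd k : (k < n)%N && (o k == Some i) -> (k <= n)%N by case/andP => /ltnW.
    case: (ex_maxnP ex bnd) => k /andP[lt_kn /eqP ok] maxk.
    have [lt_ik sti bri turn] := (oP _ _).1 ok.
    exists i, k; split=> //; split=> // l lt_ln; rewrite prox.
    split=> [[l_gt0 [il|ol]]|/andP[lt_il le_lk]]; first lia.
      have [lt_il _ _ _] := (oP _ _).1 ol.
      by have := maxk l; rewrite lt_ln ol eqxx => /(_ isT); lia.
    split; first lia.
    have [li|lt_i1l] := leqP l i.+1; first by left; lia.
    right; apply/oP; split=> // m lt_m; [apply: sti | apply: bri]; lia.
  have lt_i2n : (i.+2 < n)%N by have := run.1; lia.
  (* As [P_(i+2)] is proximate to [P_i] and e_(i+1) is straight, the path must turn at v_(i+1). *)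
  have [] := (prox i.+2 i).1 ((run.2 _ lt_i2n).2 _); first lia.
  move=> _ [|/oP[_ _ _]]; first lia.
  by rewrite -ji stj.
Qed.

(** * Combinatorial conditions satisfied by the diagram of a branch *)

Lemma normal_crossing_blow_down k c (P Q : near_point R) :
  axis_x P = None \/ axis_y P = None ->
  blow_up k c P Q -> normal_crossing Q -> normal_crossing P.
Proof.
move=> oneP [x0 [y0 step]] [_ one ax ay]; case: c step => [c|].
  case=> pxQ pyP axQ ayQ.
  have nz1 : px P 1%N != 0 by rewrite -pxQ ax // axQ.
  have py1 : py P 1%N = px P 1%N * c.
    by rewrite -pyP mul1_coef1 -!pxQ x0 mul0r add0r /= y0 add0r.
  split=> //; first by left.
  move=> nay; rewrite py1 mulf_neq0 //; apply/eqP => c0; apply: nay.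
  case: one => [|ayN]; first by rewrite axQ.
  by rewrite -ayN ayQ c0 eqxx.
case=> pyQ pxP axQ ayQ.
have nz1 : py P 1%N != 0 by rewrite -pyQ ay // ayQ.
split=> //; first by right.
by rewrite -axQ; case: one => [->|]; rewrite ?ayQ.
Qed.

Lemma resolution_axes f n (P : nat -> near_point R) k i :
  minimal_resolution f n P -> (k <= n)%N ->
  axis_x (P k) = Some i \/ axis_y (P k) = Some i -> (i < k)%N.
Proof.
case=> [[x [y [_ P0]]] step _ _]; elim: k i => [|k IHk] i lt_kn.
  by rewrite P0 => -[].
have [c [_ [_]]] := step k lt_kn; have {}IHk := IHk _ (ltnW lt_kn).
case: c => [c|] [_ _ -> ->] [].
- by case=> ->.
- by case: ifP => // _ ayi; apply/ltnW/IHk; right.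
- by move=> axi; apply/ltnW/IHk; left.
- by case=> ->.
Qed.

(** One axis is the new curve, of index [k], and the other has a smaller index or is not
    exceptional. At [P_0] both are [None], hence the shift to [k.+1]. *)
Lemma resolution_axes_neq f n (P : nat -> near_point R) k :
  minimal_resolution f n P -> (k < n)%N ->
  axis_x (P k.+1) <> axis_y (P k.+1).
Proof.
move=> res lt_kn; have [_ step _ _] := res.
have lt_axes i := @resolution_axes _ _ _ _ i res (ltnW lt_kn).
have [c [_ [_]]] := step k lt_kn; case: c => [c|] [_ _ -> ->].
  by case: ifP => // _ /esym ay; have := lt_axes _ (or_intror ay); rewrite ltnn.
by move=> ax; have := lt_axes _ (or_introl ax); rewrite ltnn.
Qed.

Lemma free_axesP (P : nat -> near_point R) k : axis_x (P k) <> axis_y (P k) ->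
  Defs.free P k <-> (axis_x (P k) = None \/ axis_y (P k) = None).
Proof.
rewrite /Defs.free /proximate; case: axis_x => [i|]; case: axis_y => [j|] neq.
- split=> [[l [_ uniq]]|[]] //; case: neq; congr Some.
  by rewrite -(uniq i (or_introl erefl)) -(uniq j (or_intror erefl)).
- by split=> [_|_]; [right | exists i; split=> [|l [[]|]]; auto].
- by split=> [_|_]; [left | exists j; split=> [|l [|[]]]; auto].
- by case: neq.
Qed.

Lemma enriques_admissible n (d : decoration n) : (3 <= n)%N ->
  enriques R n d -> admissible d.
Proof.
move=> n_ge3 [f [P [_ res [stE runE brE]]]].
have free_axes k : (k < n)%N -> Defs.free P k.+1 <->
    (axis_x (P k.+1) = None \/ axis_y (P k.+1) = None).
  by move=> lt_kn; apply/free_axesP/(resolution_axes_neq res).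
have stP k : (k < n)%N -> mem_nat (straight d) k <-> (0 < k)%N /\ ~ Defs.free P k.
  by move=> lt_kn; have := stE (Ordinal lt_kn); rewrite -mem_natE.
split.
- move=> k stk; have [k_gt0 nfree] := (stP k (mem_nat_ltn stk)).1 stk.
  rewrite ltn_neqAle k_gt0 andbT; apply/eqP => k1; case: nfree.
  rewrite -k1; apply/free_axes; first lia.
  have [[x [y [_ P0]]] step _ _] := res.
  have [c [_ [_]]] := step 0%N ltac:(lia); rewrite P0.
  by case: c => [c|] [_ _ -> ->] /=; [right; case: ifP | left].
- have [_ step ncN nc] := res.
  apply/stP; first lia; split; first lia.
  have -> : n.-1 = n.-2.+1 by lia.
  have lt2 : (n.-2 < n)%N by lia.
  move=> /(free_axes _ lt2); have -> : n.-2.+1 = n.-1 by lia.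
  have lt1 : (n.-1 < n)%N by lia.
  (* Were [P_(n-1)] free, normal crossings at [P_n] would descend to it, and its blow-up would
     contradict minimality. *)
  have [c bu] := step _ lt1; move=> oneP; apply: (ncN _ lt1).
  apply: (normal_crossing_blow_down oneP bu).
  by have -> : n.-1.+1 = n by lia.
- move=> k brk; have lt_kn := mem_nat_ltn brk.
  have := brE (Ordinal lt_kn); rewrite -!mem_natE /= => brkE.
  have [i [l [run lt_il ki stk]]] := brkE.1 brk.
  have [lt_ln _] := run.
  have [/(straight_pathP _ _ lt_ln)[st' _] _ _] := runE i l run lt_il.
  by rewrite stk ki st' //; lia.
Qed.

End Realization.

(** * Codes and duality *)

Section FenceCode.
Variable n : nat.
Local Notation N := (n - 3).*2.
Implicit Types (d : decoration n) (D : {set 'I_N}).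

(* The symbols in the order [v_(n-2), e_(n-2), v_(n-3), e_(n-3), ..., v_2, e_2]:
   a breaking vertex needs both adjacent edges straight, so that the codes of
   Enriques diagrams become the downsets of a fence. *)
Definition vertex_rank k := (n - 2 - k).*2.
Definition edge_rank k := (n - 2 - k).*2.+1.

Definition fence_code d : {set 'I_N} :=
  [set i : 'I_N | if odd i then mem_nat (straight d) (n - 2 - i./2)
                  else mem_nat (breaking d) (n - 2 - i./2)].

Lemma mem_nat_finset m (P : pred nat) k :
  mem_nat [set i : 'I_m | P i] k = (k < m)%N && P k.
Proof.
apply/idP/andP => [Pk|[lt_km Pk]].
  have lt_km := mem_nat_ltn Pk; split=> //.
  by move: Pk; rewrite (mem_natE _ (Ordinal lt_km)) inE.
by rewrite (mem_natE _ (Ordinal lt_km)) inE.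
Qed.

Lemma mem_nat_fence_code d i : mem_nat (fence_code d) i = (i < N)%N &&
  if odd i then mem_nat (straight d) (n - 2 - i./2) else mem_nat (breaking d) (n - 2 - i./2).
Proof.
exact: (@mem_nat_finset N (fun i => if odd i then mem_nat (straight d) (n - 2 - i./2)
                               else mem_nat (breaking d) (n - 2 - i./2))).
Qed.

Lemma mem_vertex_rank d k : (2 <= k <= n - 2)%N ->
  mem_nat (fence_code d) (vertex_rank k) = mem_nat (breaking d) k.
Proof.
move=> lt_k; rewrite mem_nat_fence_code odd_double doubleK.
have -> : (vertex_rank k < N)%N by rewrite /vertex_rank; lia.
by have -> : (n - 2 - (n - 2 - k) = k)%N by lia.
Qed.

Lemma mem_edge_rank d k : (2 <= k <= n - 2)%N ->
  mem_nat (fence_code d) (edge_rank k) = mem_nat (straight d) k.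
Proof.
move=> lt_k; rewrite mem_nat_fence_code /= odd_double uphalf_double.
have -> : (edge_rank k < N)%N by rewrite /edge_rank; lia.
by have -> : (n - 2 - (n - 2 - k) = k)%N by lia.
Qed.

Lemma rankP i : (i < N)%N -> exists2 k, (2 <= k <= n - 2)%N &
  i = vertex_rank k \/ i = edge_rank k.
Proof.
move=> lt_i; exists (n - 2 - i./2)%N; first lia.
by rewrite /vertex_rank /edge_rank; have := odd_double_half i; case: odd; lia.
Qed.

Lemma fence_code_sub d d' :
  (fence_code d \subset fence_code d') = (code d \subset code d').
Proof.
have inner (l : 'I_n) : (2 <= l <= n - 2)%N -> (vertex_rank l < N)%N /\ (edge_rank l < N)%N.
  by rewrite /vertex_rank /edge_rank; lia.
apply/idP/idP => /fintype.subsetP sub; apply/fintype.subsetP.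
  move=> [] l; rewrite !inE => /andP[lt_l dl]; rewrite lt_l /=.
    have [lt_v _] := inner l lt_l; have := sub (Ordinal lt_v).
    by rewrite -!mem_natE /= !mem_vertex_rank // !mem_natE; apply.
  have [_ lt_e] := inner l lt_l; have := sub (Ordinal lt_e).
  by rewrite -!mem_natE /= !mem_edge_rank // !mem_natE; apply.
move=> i; have [k lt_k] := rankP (ltn_ord i).
have lt_kn : (k < n)%N by lia.
have sub_v := sub (inl (Ordinal lt_kn)); have sub_e := sub (inr (Ordinal lt_kn)).
rewrite !inE lt_k /= -!mem_natE /= in sub_v sub_e.
by case=> ik; rewrite -!mem_natE ik ?mem_vertex_rank ?mem_edge_rank.
Qed.

(** Outside the range from 2 to [n - 2], admissibility prescribes every decoration. *)
Lemma fence_code_inj d d' : admissible d -> admissible d' ->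
  fence_code d = fence_code d' -> d = d'.
Proof.
move=> [st_gt1 st_last br_st] [st_gt1' st_last' br_st'] eq_c.
have eq_st k : mem_nat (straight d) k = mem_nat (straight d') k.
  have [lt_k|Nk] := boolP (2 <= k <= n - 2)%N.
    by rewrite -!mem_edge_rank // eq_c.
  have [->|nk] := eqVneq k n.-1; first by rewrite st_last st_last'.
  by apply/idP/idP => stk; have := mem_nat_ltn stk;
    [have := st_gt1 _ stk | have := st_gt1' _ stk]; lia.
have eq_br k : mem_nat (breaking d) k = mem_nat (breaking d') k.
  have [lt_k|Nk] := boolP (2 <= k <= n - 2)%N.
    by rewrite -!mem_vertex_rank // eq_c.
  by apply/idP/idP; [move/br_st | move/br_st'] => /andP[stk /mem_nat_ltn];
    [have := st_gt1 _ stk | have := st_gt1' _ stk]; lia.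
by case: d d' eq_st eq_br {eq_c st_gt1 st_last br_st st_gt1' st_last' br_st'}
  => [s b] [s' b'] /= /eq_mem_nat-> /eq_mem_nat->.
Qed.

(** The neighbours of v_k in the fence are its adjacent edges e_k and e_(k+1), except that e_(n-1),
    always straight, is left out of the fence. *)
Lemma downset_fence_code d : admissible d -> downset (@fence N) (fence_code d).
Proof.
move=> [st_gt1 st_last br_st]; apply/downsetP => i j.
rewrite /fence => di /predU1P[-> //|/andP[odd_j adj]]; move: di.
have [k lt_k [ik|ik]] := rankP (ltn_ord i); last by move: adj ik odd_j; rewrite /edge_rank /=; lia.
rewrite -!mem_natE ik mem_vertex_rank // => /br_st/andP[stk stk1].
case/orP: adj => /eqP ij.
  have -> : val j = edge_rank k by rewrite ij /= ik.
  by rewrite mem_edge_rank.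
have lt_k1 : (2 <= k.+1 <= n - 2)%N.
  by move: ij; rewrite /= ik /vertex_rank; lia.
have -> : val j = edge_rank k.+1.
  by move: ij; rewrite /= ik /vertex_rank /edge_rank; lia.
by rewrite mem_edge_rank.
Qed.

Lemma fence_code_surj D : (3 <= n)%N -> downset (@fence N) D ->
  exists2 d, admissible d & fence_code d = D.
Proof.
move=> n_ge3 /downsetP dD.
pose inner k := (2 <= k <= n - 2)%N.
pose d := Decoration [set k : 'I_n | (k == n.-1 :> nat) || inner k && mem_nat D (edge_rank k)]
  [set k : 'I_n | inner k && mem_nat D (vertex_rank k)].
have stE k : mem_nat (straight d) k =
    (k < n)%N && ((k == n.-1) || inner k && mem_nat D (edge_rank k)).
  exact: (@mem_nat_finset n (fun k => (k == n.-1) || inner k && mem_nat D (edge_rank k))).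
have brE k : mem_nat (breaking d) k = (k < n)%N && (inner k && mem_nat D (vertex_rank k)).
  exact: (@mem_nat_finset n (fun k => inner k && mem_nat D (vertex_rank k))).
have onD i j : mem_nat D i -> odd j -> (j < N)%N -> (j == i.+1) || (i == j.+1) -> mem_nat D j.
  move=> Di odd_j lt_j adj; have lt_i := mem_nat_ltn Di.
  rewrite (mem_natE _ (Ordinal lt_i)) in Di; rewrite (mem_natE _ (Ordinal lt_j)).
  by apply: (dD _ _ Di); rewrite /fence /= odd_j adj orbT.
exists d; last first.
  apply: eq_mem_nat => i; have [lt_i|le_i] := ltnP i N; last first.
    by apply/idP/idP => /mem_nat_ltn; rewrite ltnNge le_i.
  have [k lt_k [->|->]] := rankP lt_i.
    by rewrite mem_vertex_rank // brE /inner lt_k; have -> : (k < n)%N by lia.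
  rewrite mem_edge_rank // stE /inner lt_k; have -> : (k < n)%N by lia.
  by have -> : (k == n.-1) = false by lia.
split.
- by move=> k; rewrite stE /inner; lia.
- by rewrite stE eqxx; lia.
- move=> k; rewrite brE !stE => /and3P[lt_kn lt_k Dk]; rewrite lt_kn lt_k /=.
  have Dek : mem_nat D (edge_rank k).
    apply: (onD _ _ Dk); rewrite /edge_rank /vertex_rank ?eqxx //=.
      by rewrite odd_double.
    by move: lt_k; rewrite /inner; lia.
  (* For [k = n - 2] the edge e_(n-1) has no position in the fence, but is straight by
     construction. *)
  rewrite Dek orbT /=; have [-> |lt_k1] := eqVneq k.+1 n.-1; first by lia.
  have -> : inner k.+1 by move: lt_k lt_k1; rewrite /inner; lia.
  have -> : (k.+1 < n)%N by move: lt_k; rewrite /inner; lia.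
  by apply: (onD _ _ Dk); move: lt_k lt_k1; rewrite /inner /edge_rank /vertex_rank; lia.
Qed.

Definition rev_compl D : {set 'I_N} := [set i | rev_ord i \notin D].

Lemma in_rev_compl D i : (i \in rev_compl D) = (rev_ord i \notin D).
Proof. by rewrite inE. Qed.

Lemma rev_complK : involutive rev_compl.
Proof. by move=> D; apply/finset.setP => i; rewrite !inE negbK rev_ordK. Qed.

Lemma rev_compl_sub D (E : {set 'I_N}) : D \subset E -> rev_compl E \subset rev_compl D.
Proof.
by move/fintype.subsetP=> sDE; apply/fintype.subsetP => i; rewrite !inE; apply: contra; apply: sDE.
Qed.

(** The complement is an upset, and the reversal of an even fence turns upsets into downsets. *)
Lemma downset_rev_compl D : downset (@fence N) D -> downset (@fence N) (rev_compl D).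
Proof.
move/downsetP => dD; apply/downsetP => i j; rewrite !inE => Ni ji.
apply: contra Ni => Dj; apply: dD Dj _.
by rewrite fence_rev ?odd_double.
Qed.

End FenceCode.

(** * The dual diagram and the uniqueness of the order-reversing bijection *)

Section Main.
Variables (R : realType) (n : nat).
Hypothesis n_ge3 : (3 <= n)%N.
Local Notation N := (n - 3).*2.
Local Notation T := {D : {set 'I_N} | downset (@fence N) D}.
Implicit Types e : enriques R n.

Lemma admissible_val e : admissible (val e).
Proof. by apply: (@enriques_admissible R) => //; apply: set_valP. Qed.

Lemma staircase_leE e e' :
  staircase_le e e' = (fence_code (val e) \subset fence_code (val e')).
Proof. by rewrite fence_code_sub. Qed.

Lemma fence_code_val_inj e e' : fence_code (val e) = fence_code (val e') -> e = e'.
Proof.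
by move=> eq_c; apply/val_inj/(fence_code_inj _ _ eq_c); apply: admissible_val.
Qed.

Lemma fence_code_val_surj D : downset (@fence N) D ->
  exists e, fence_code (val e) = D.
Proof.
move=> dD; have [d adm_d <-] := fence_code_surj n_ge3 dD.
by exists (SigSub (mem_set (admissible_enriques R n_ge3 adm_d))).
Qed.

(** Reversing the fence exchanges the positions of v_k and e_(n-k); complementation accounts for the
    negations in the rules of duality. *)
Lemma dual_ofP e e' :
  dual_of e e' <-> fence_code (val e') = rev_compl (fence_code (val e)).
Proof.
have flip (i : 'I_N) k l : (2 <= k <= n - 2)%N -> l = (n - k)%N ->
    (i = vertex_rank n k :> nat -> rev_ord i = edge_rank n l :> nat) /\
    (i = edge_rank n k :> nat -> rev_ord i = vertex_rank n l :> nat).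
  by move=> lt_k ->; rewrite /= /edge_rank /vertex_rank; split=> ->; lia.
split=> [dual|eq_c k l lt_k lE].
  apply/finset.setP => i; rewrite in_rev_compl.
  have [k lt_k ik] := rankP (ltn_ord i); have [fv fe] := flip i k _ lt_k erefl.
  have ltk : (k < n)%N by lia.
  have ltl : (n - k < n)%N by lia.
  have lt_l : (2 <= n - k <= n - 2)%N by lia.
  have [] := dual (Ordinal ltk) (Ordinal ltl) lt_k erefl; rewrite -!mem_natE => brk stk.
  rewrite /= in brk stk; case: ik => ik.
    by rewrite ik (fv ik) mem_vertex_rank // mem_edge_rank.
  by rewrite ik (fe ik) mem_edge_rank // mem_vertex_rank.
have lt_l : (2 <= l <= n - 2)%N by rewrite lE; lia.
have ltv : (vertex_rank n k < N)%N by rewrite /vertex_rank; lia.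
have lte : (edge_rank n k < N)%N by rewrite /edge_rank; lia.
have [fv _] := flip (Ordinal ltv) k _ lt_k lE.
have [_ fe] := flip (Ordinal lte) k _ lt_k lE.
have := congr1 (fun D : {set 'I_N} => Ordinal ltv \in D) eq_c.
have := congr1 (fun D : {set 'I_N} => Ordinal lte \in D) eq_c.
rewrite !in_rev_compl -!mem_natE (fv erefl) (fe erefl) /=.
by rewrite !mem_vertex_rank // !mem_edge_rank.
Qed.

End Main.

Theorem theorem8p5 (R : realType) (n : nat) (n_ge3 : (3 <= n)%N) :
  exists Delta : enriques R n -> enriques R n,
    [/\ forall e e' : enriques R n, dual_of e e' <-> e' = Delta e,
        involutive Delta,
        bijective Delta,
        reverses_staircase Delta
      & forall f : enriques R n -> enriques R n,
          bijective f -> reverses_staircase f -> forall e, f e = Delta e].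
Proof.
pose N := (n - 3).*2; pose T := {D : {set 'I_N} | downset (@fence N) D}.
have code_down (e : enriques R n) : downset (@fence N) (fence_code (val e)).
  by apply: downset_fence_code; apply: admissible_val.
have [e|Delta DeltaE] := @boolp.choice (enriques R n) (enriques R n)
  (fun e e' => fence_code (val e') = rev_compl (fence_code (val e))).
  exact/(fence_code_val_surj R n_ge3)/downset_rev_compl.
have [D|psi psiE] := @boolp.choice T (enriques R n)
  (fun D e => fence_code (val e) = val D).
  exact/(fence_code_val_surj R n_ge3)/valP.
have DeltaK : involutive Delta.
  by move=> e; apply: (fence_code_val_inj n_ge3); rewrite !DeltaE rev_complK.
have revDelta : reverses_staircase Delta.
  by move=> e e'; rewrite !staircase_leE !DeltaE; apply: rev_compl_sub.
exists Delta; split=> //.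
- move=> e e'; rewrite (dual_ofP n_ge3) -DeltaE; split=> [|-> //].
  exact: (fence_code_val_inj n_ge3).
- exact: inv_bij.
move=> f bij_f rev_f e; apply: (can_inj DeltaK); rewrite DeltaK.
pose phi e : T := exist (fun D => downset (@fence N) D) _ (code_down e).
have phiK : cancel phi psi by move=> x; apply: (fence_code_val_inj n_ge3); rewrite psiE.
have psiK : cancel psi phi by move=> D; apply: val_inj; rewrite /= psiE.
(* A composite of two order-reversing bijections, transported to downsets, preserves inclusion;
   rigidity makes it the identity, so [f] is the inverse of the involution [Delta]. *)
pose g D := phi (Delta (f (psi D))).
have g_id : g =1 id.
  apply: (@downset_automorphism_id _ (@fence N)).
  - exact: fence_refl.
  - exact: fence_trans.
  - exact: fence_anti.
  - apply: inj_comp (can_inj phiK) _; apply: inj_comp (can_inj DeltaK) _.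
    exact: inj_comp (bij_inj bij_f) (can_inj psiK).
  - move=> D E sDE; rewrite /= -staircase_leE; apply/revDelta/rev_f.
    by rewrite staircase_leE !psiE.
  - by move=> p; apply: fence_rigid; rewrite odd_double.
by have := g_id (phi e); rewrite /g phiK => /(can_inj phiK).
Qed.
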